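(* Let $r\ge 3$ and $s$ be coprime odd integers with $0<s<r$, $q=\exp(i\pi s/r)$. Define $P_n\in\mathbb{Z}[X]$ by $P_0=1$, $P_1=X$, $P_{n+1}=XP_n+\epsilon_n\epsilon_{n+1}P_{n-1}$ for $1\le n\le r-2$; then $P_{r-2},P_{r-1}$ are coprime monic of degrees $r-2,r-1$ and $$\frac{P_{r-1}}{P_{r-2}}=X+\cfrac{\epsilon_1\epsilon_2}{X+\cfrac{\epsilon_2\epsilon_3}{X+\cfrac{\cdots}{\cdots+\cfrac{\epsilon_{r-2}\epsilon_{r-1}}{X}}}}.$$ Moreover: (i) the map $X\mapsto e_1$ induces an algebra isomorphism $\mathbb{Q}[X]/(P_{r-1})\cong V_q$; (ii) for every $f\in\mathbb{Q}[X]$, $$\epsilon(f(e_1))=\sum_{z\in\mathbb{C},\,P_{r-1}(z)=0}\operatorname{Res}_{z}\left(\frac{f\,P_{r-2}}{P_{r-1}}\right);$$ (iii) $P_{r-1}(X)=R(X^2)$, where $R$ is the Riley polynomial.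
   Context: For an integer $n$ put $[n]=\frac{q^n-q^{-n}}{q-q^{-1}}$, $[n]!=[n][n-1]\cdots[1]$, and for $1\le n\le r-1$ let $\epsilon_n=\operatorname{sign}[n]=(-1)^{\lfloor ns/r\rfloor}$ (so $\epsilon_1=1$ and $\epsilon_n=\epsilon_{r-n}$). A triple $(i,j,k)\in\{0,\dots,r-2\}^3$ is $r$-admissible if $i\le j+k$, $j\le i+k$, $k\le i+j$, $i+j+k$ is even and $i+j+k\le 2r-4$; for such a triple write $i=b+c$, $j=a+c$, $k=a+b$ and set $\langle i,j,k\rangle=(-1)^{a+b+c}\frac{[a+b+c+1]![a]![b]![c]!}{[a+b]![a+c]![b+c]!}$ (a nonzero real number). Let $V_q$ be the $\mathbb{Q}$-vector space with basis $e_0,\dots,e_{r-2}$, with the symmetric bilinear form $\eta$ for which this basis is orthogonal and $\eta(e_i,e_i)=(-1)^i\epsilon_{i+1}$, and the symmetric trilinear form $\omega$ with $\omega(e_i,e_j,e_k)=\operatorname{sign}\langle i,j,k\rangle$ if $(i,j,k)$ is $r$-admissible and $0$ otherwise. The product on $V_q$ is defined by $\eta(x\cdot y,z)=\omega(x,y,z)$; this makes $V_q$ a commutative associative unital $\mathbb{Q}$-algebra with unit $e_0$ and a Frobenius algebra with counit $\epsilon(f)=\eta(f,e_0)$ (so $\eta(x,y)=\epsilon(xy)$). The Riley polynomial $R(t)\in\mathbb{Z}[t]$ is the upper-left entry of the matrix product $A_1A_2\cdots A_{r-1}$, where $A_k=\begin{pmatrix}1&1\\0&1\end{pmatrix}^{\epsilon_k}$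 for $k$ odd and $A_k=\begin{pmatrix}1&0\\t&1\end{pmatrix}^{\epsilon_k}$ for $k$ even. *)

(* Defs.v *)
From HB Require Import structures.
From Stdlib Require Import Rdefinitions Rtrigo_def Rtrigo1.
From mathcomp Require Import all_boot all_order all_algebra all_field.
From mathcomp Require Import Rstruct.
Set Implicit Arguments. Unset Strict Implicit. Unset Printing Implicit Defensive.
Import Order.TTheory GRing.Theory Num.Theory.
Local Open Scope ring_scope.

(* [n] = (q^n - q^-n)/(q - q^-1) = sin(n pi s / r) / sin(pi s / r)  (a real number) *)
Definition qint (r s n : nat) : R :=
  sin (n%:R * PI * s%:R / r%:R) / sin (PI * s%:R / r%:R).

Definition qfact (r s n : nat) : R := \prod_(1 <= m < n.+1) qint r s m.

Definition eps (r s n : nat) : int := sgz (qint r s n).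

Fixpoint Ppair (r s n : nat) : {poly int} * {poly int} :=
  match n with
  | 0 => (1, 'X)
  | n'.+1 => let: (a, b) := Ppair r s n' in
             (b, 'X * b + (eps r s n'.+1 * eps r s n'.+2)%:P * a)
  end.
Definition Ppoly (r s n : nat) : {poly int} := (Ppair r s n).1.

Notation tofrac := (@FracField.tofrac _).

Fixpoint cfrac (r s n j : nat) : {fraction {poly int}} :=
  match n with
  | 0 => tofrac 'X
  | n'.+1 => tofrac 'X + tofrac ((eps r s j * eps r s j.+1)%:P) / cfrac r s n' j.+1
  end.

Section Vq.
Variables r s : nat.
Local Notation n := (r - 1)%N.
Definition Vq := 'rV[rat]_n.

(* basis vector e_i (e_i = 0 if i >= r-1, never used) *)
Definition ebasis (i : nat) : Vq := \row_(k < n) (k == i :> nat)%:R.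

Definition admissible (i j k : nat) : bool :=
  [&& i <= j + k, j <= i + k, k <= i + j, ~~ odd (i + j + k)
    & i + j + k <= 2 * r - 4]%N.

(* < i, j, k > with i = b+c, j = a+c, k = a+b *)
Definition theta (i j k : nat) : R :=
  let a := ((j + k - i) %/ 2)%N in
  let b := ((i + k - j) %/ 2)%N in
  let c := ((i + j - k) %/ 2)%N in
  (-1) ^+ (a + b + c) *
  (qfact r s (a + b + c + 1) * qfact r s a * qfact r s b * qfact r s c) /
  (qfact r s (a + b) * qfact r s (a + c) * qfact r s (b + c)).

Definition eta_diag (i : nat) : rat := (-1) ^+ i * (eps r s i.+1)%:~R.
Definition omega_coef (i j k : nat) : rat :=
  if admissible i j k then (sgz (theta i j k))%:~R else 0.

Definition eta (x y : Vq) : rat := \sum_(i < n) x 0 i * y 0 i * eta_diag i.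
Definition omega (x y z : Vq) : rat :=
  \sum_(i < n) \sum_(j < n) \sum_(k < n) x 0 i * y 0 j * z 0 k * omega_coef i j k.

(* the product, determined by eta (x.y, z) = omega (x, y, z);
   since eta is diagonal with entries +-1 the k-th coordinate is
   omega(x, y, e_k) / eta(e_k, e_k) *)
Definition vmul (x y : Vq) : Vq :=
  \row_(k < n) (omega x y (ebasis k) / eta (ebasis k) (ebasis k)).

Definition counit (x : Vq) : rat := eta x (ebasis 0).

Definition vpow (v : Vq) (m : nat) : Vq := iter m (vmul v) (ebasis 0).
Definition veval (f : {poly rat}) (v : Vq) : Vq :=
  \sum_(i < size f) f`_i *: vpow v i.
End Vq.
Arguments eta : clear implicits.
Arguments omega : clear implicits.
Arguments vmul : clear implicits.
Arguments counit : clear implicits.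
Arguments vpow : clear implicits.
Arguments veval : clear implicits.

Definition toQ (p : {poly int}) : {poly rat} := map_poly (fun z : int => z%:~R) p.
Definition toC (p : {poly int}) : {poly algC} := map_poly (fun z : int => z%:~R) p.

(* first m coefficients of the power series inverse of c (c`_0 <> 0) *)
Fixpoint psinv (F : fieldType) (c : {poly F}) (m : nat) : seq F :=
  if m is m'.+1 then
    let u := psinv c m' in
    rcons u ((c`_0)^-1 * ((m' == 0%N)%:R - \sum_(1 <= j < m'.+1) c`_j * u`_(m' - j)))
  else [::].

(* Res_z (A / B): coefficient of (X - z)^-1 in the Laurent expansion of A/B at z.
   Writing B = (X - z)^m C with C(z) <> 0 (m = multiplicity of z), this is the
   coefficient of (X - z)^(m-1) in the Taylor expansion of A/C at z. *)
Definition residue (F : fieldType) (A B : {poly F}) (z : F) : F :=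
  let m := mup z B in
  let C := B %/ ('X - z%:P) ^+ m in
  let sh p := p \Po ('X + z%:P) in
  let u := psinv (sh C) m in
  \sum_(i < m) (sh A)`_i * u`_(m.-1 - i).

(* A_k = [[1,1],[0,1]]^{eps_k} = [[1,eps_k],[0,1]] (k odd),
   A_k = [[1,0],[t,1]]^{eps_k} = [[1,0],[eps_k t,1]] (k even), eps_k = +-1 *)
Definition rileyA (r s k : nat) : 'M[{poly int}]_2 :=
  if odd k then \matrix_(i < 2, j < 2)
                  (if (i == j) then 1 else if (i == 0 :> nat) then (eps r s k)%:P else 0)
  else \matrix_(i < 2, j < 2)
                  (if (i == j) then 1 else if (i == 1 :> nat) then (eps r s k)%:P * 'X else 0).

Definition riley (r s : nat) : {poly int} :=
  (\prod_(1 <= k < r) rileyA r s k) ord0 ord0.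

(* Main.v *)
(** The signs [eps_n] enter only through the four-term relation
    [[a+b+c][a] + [b][c] = [a+b][a+c]] between quantum integers: it gives
    [e_1 (e_j e_i) = (e_1 e_j) e_i], where only two intermediate labels occur on
    each side. Together with the three-term recurrence for [e_1 e_j] this shows
    [e_j = P_j (e_1)], that [f (e_1)] acts on [V_q] as the polynomial [f] in
    multiplication by [e_1], and hence part (i). The counit of [x] is the last
    coordinate of [x e_{r-2}], that is, the coefficient of [X^(r-2)] in
    [f P_{r-2} mod P_{r-1}], which is the sum of the residues by partial
    fractions. The symmetry [eps_n = eps_{r-n}] reverses the continued fraction
    and makes the product of all the signs equal to 1 in (iii). *)

Require Import Defs.
From HB Require Import structures.
From Stdlib Require Import Rdefinitions Rtrigo_def Rtrigo1.
From mathcomp Require Import all_boot all_order all_algebra all_field.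
From mathcomp Require Import Rstruct ring zify.
Import Order.TTheory GRing.Theory Num.Theory.
Local Open Scope ring_scope.

(** * Sums of residues *)

Section Residue.
Variable F : fieldType.
Implicit Types (A B C : {poly F}) (z : F).

Lemma size_psinv (C : {poly F}) (m : nat) : size (psinv C m) = m.
Proof. by elim: m => //= m IH; rewrite size_rcons IH. Qed.

Lemma nth_psinv (C : {poly F}) (m i : nat) : (i < m)%N ->
  (psinv C m)`_i = (C`_0)^-1 *
    ((i == 0%N)%:R - \sum_(1 <= j < i.+1) C`_j * (psinv C m)`_(i - j)).
Proof.
elim: m => // m IH im.
have stable j : (j < m)%N -> (psinv C m.+1)`_j = (psinv C m)`_j.
  by move=> jm; rewrite /= nth_rcons size_psinv jm.
have [im'|] := ltnP i m.
  rewrite stable // IH //; congr (_ * (_ - _)).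
  by apply: eq_big_nat => j /andP[j0 ji]; rewrite stable //; lia.
move=> mi; have -> : i = m by lia.
rewrite [LHS]/= nth_rcons size_psinv ltnn eqxx; congr (_ * (_ - _)).
by apply: eq_big_nat => j /andP[j0 ji]; rewrite stable //; lia.
Qed.

Lemma psinv_conv (C : {poly F}) (m i : nat) : C`_0 != 0 -> (i < m)%N ->
  \sum_(j < i.+1) C`_j * (psinv C m)`_(i - j) = (i == 0%N)%:R.
Proof.
move=> C0 im; rewrite big_ord_recl subn0 nth_psinv // mulVKf //.
by rewrite big_add1 big_mkord /= subrK.
Qed.

(** As a single coefficient of a product of polynomials the residue is open to the ring laws; the
    shift turns powers of [X - z] into powers of [X]. *)
Lemma residue_coef A B z : residue A B z =
  if mup z B is m.+1 then
    ((A \Po ('X + z%:P)) *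
     Poly (psinv ((B %/ ('X - z%:P) ^+ m.+1) \Po ('X + z%:P)) m.+1))`_m
  else 0.
Proof.
rewrite /residue; case: (mup z B) => [|m]; first by rewrite big_ord0.
by rewrite coefM; apply: eq_bigr => i _; rewrite coef_Poly.
Qed.

Lemma residueP (a : F) A A' B z :
  residue (a *: A + A') B z = a * residue A B z + residue A' B z.
Proof.
rewrite !residue_coef; case: (mup z B) => [|m]; first by rewrite mulr0 addr0.
by rewrite comp_polyD comp_polyZ mulrDl -scalerAl coefD coefZ.
Qed.

Lemma comp_XsubC_exp (m : nat) z : (('X - z%:P) ^+ m) \Po ('X + z%:P) = 'X^m.
Proof. by rewrite rmorphXn /= comp_polyB comp_polyX comp_polyC addrK. Qed.

(** The numerator absorbs the whole pole: after the shift it is a multiple of a power of [X] beyond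
    the coefficient that is read. *)
Lemma residue_dvd A B z : ('X - z%:P) ^+ mup z B %| A -> residue A B z = 0.
Proof.
rewrite residue_coef; case: (mup z B) => // m /dvdpP[A' ->].
by rewrite comp_polyM comp_XsubC_exp mulrAC coefMXn ltnSn.
Qed.

Lemma mup_cofactor B z : B != 0 ->
  exists2 C, B = C * ('X - z%:P) ^+ mup z B & ~~ root C z.
Proof.
move=> B0; have : ('X - z%:P) ^+ mup z B %| B by rewrite -mup_geq.
move=> /dvdpP[C BE]; exists C => //; apply/negP => /factor_theorem[D DE].
have : ('X - z%:P) ^+ (mup z B).+1 %| B.
  by rewrite [X in _ %| X]BE DE -mulrA -exprS dvdp_mull.
by rewrite -mup_geq // ltnn.
Qed.

(** Over [B] the quotient is [1 / (X - z)^(m + 1)]; formally the claim is [psinv_conv] for the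
    cofactor of [B] at [z]. *)
Lemma residue_simple B z (m : nat) : B != 0 -> (m < mup z B)%N ->
  residue (B %/ ('X - z%:P) ^+ m.+1) B z = (m == 0%N)%:R.
Proof.
move=> B0 hm; have [C BE Cz] := mup_cofactor B z B0.
have e0 k : ('X - z%:P) ^+ k != 0 by rewrite expf_neq0 // polyXsubC_eq0.
rewrite residue_coef; case E : (mup z B) => [|M]; first by rewrite E in hm.
have -> : B %/ ('X - z%:P) ^+ M.+1 = C by rewrite {1}BE E mulpK.
have -> : B %/ ('X - z%:P) ^+ m.+1 = C * ('X - z%:P) ^+ (M - m).
  rewrite {1}BE E (_ : M.+1 = M - m + m.+1)%N ?exprD ?mulrA ?mulpK //; lia.
rewrite comp_polyM comp_XsubC_exp mulrAC coefMXn.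
rewrite ltnNge leq_subr /= subKn; last by rewrite -ltnS -E.
have C0 : (C \Po ('X + z%:P))`_0 != 0.
  by rewrite -horner_coef0 horner_comp hornerD hornerX hornerC add0r.
rewrite -(@psinv_conv (C \Po ('X + z%:P)) M.+1 m C0); last by rewrite -E.
by rewrite coefM; apply: eq_bigr => i _; rewrite coef_Poly.
Qed.
End Residue.

(* Partial fractions: peeling off a root [z] of a divisor [B1] of [B] leaves a
   multiple of [B / (X - z)^(m + 1)] plus a polynomial divisible by [X - z]. *)
Lemma partial_fraction_ind (F : closedFieldType) (B : {poly F}) (T : {poly F} -> Prop) :
    B != 0 -> T 0 -> (forall a p q, T p -> T q -> T (a *: p + q)) ->
    (forall z m, (m < mup z B)%N -> T (B %/ ('X - z%:P) ^+ m.+1)) ->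
  forall A : {poly F}, (size A < size B)%N -> T A.
Proof.
move=> B0 T0 TP Tz.
(* Generalized for an induction on the degree [k] of [B1]: [D] collects the factors already removed
   from [B]. *)
suff H (k : nat) (B1 D A : {poly F}) : size B1 = k.+1 -> B = D * B1 ->
    (size A < size B1)%N -> T (D * A).
  move=> A hA; rewrite -[A]mul1r; apply: (H (size B).-1 B); rewrite ?mul1r //.
  by rewrite prednK // size_poly_gt0.
elim: k B1 D A => [|k IH] B1 D A sB1 BE.
  by rewrite sB1 ltnS leqn0 size_poly_eq0 => /eqP ->; rewrite mulr0.
move=> hA; have [z z1] : exists z, root B1 z by apply/closed_rootP; rewrite sB1.
have B10 : B1 != 0 by rewrite -size_poly_gt0 sB1.
have [C CE Cz] := mup_cofactor _ B1 z B10.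
have m0 : (0 < mup z B1)%N by rewrite -XsubC_dvd // -root_factor_theorem.
set m := mup z B1 in CE m0.
have C0 : C != 0 by apply: contraNneq Cz => ->; rewrite root0.
have sCm : size B1 = (size C + m)%N.
  rewrite CE size_mul ?expf_neq0 ?polyXsubC_eq0 // size_exp_XsubC addnS //.
(* The constant makes the difference vanish at [z], so that one factor [X - z] can pass from [B1] to
   [D]. *)
have : root (A - (A.[z] / C.[z]) *: C) z.
  by rewrite /root hornerD hornerN hornerZ divfK ?subrr.
move=> /factor_theorem[A1 AE].
have -> : D * A = (A.[z] / C.[z]) *: (D * C) + (D * ('X - z%:P)) * A1.
  by rewrite -mulrA [_ * A1]mulrC -AE mulrBr -scalerAr addrC subrK.
have DC : D * C = B %/ ('X - z%:P) ^+ m.-1.+1.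
  by rewrite prednK // BE CE mulrA mulpK // expf_neq0 // polyXsubC_eq0.
apply: TP.
  rewrite DC; apply: Tz; rewrite prednK // mup_geq // BE CE mulrA.
  exact: dvdp_mull.
have B1E : B1 = ('X - z%:P) * (C * ('X - z%:P) ^+ m.-1).
  by rewrite mulrCA -exprS prednK.
have C20 : C * ('X - z%:P) ^+ m.-1 != 0.
  by rewrite mulf_neq0 // expf_neq0 // polyXsubC_eq0.
have sB2 : size (C * ('X - z%:P) ^+ m.-1) = k.+1.
  apply: succn_inj; rewrite -sB1 B1E.
  by rewrite [RHS]size_mul ?polyXsubC_eq0 // size_XsubC.
apply: (IH (C * ('X - z%:P) ^+ m.-1)) => //; first by rewrite BE {1}B1E mulrA.
have [->|A10] := eqVneq A1 0; first by rewrite size_poly0 sB2.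
have : (size (A1 * ('X - z%:P))%R <= k.+1)%N.
  rewrite -AE (leq_trans (size_polyD _ _)) // geq_max size_polyN.
  rewrite -ltnS -sB1 hA -ltnS -sB1.
  by rewrite (leq_ltn_trans (size_scale_leq _ _)) // sCm -addn1 leq_add2l.
by rewrite size_mul ?polyXsubC_eq0 // size_XsubC addn2 sB2.
Qed.

(** Both sides are linear in [A] and depend only on [A] modulo [B], so by partial fractions
    [A = B / (X - z)^(m + 1)] suffices. Then [A / B] has residue 1 at [z] if [m = 0] and 0
    otherwise, and no pole at the other roots; on the right, [A] is monic of degree [deg B - m - 1],
    while [(size B).-2] is [deg B - 1]. *)
Lemma sum_residue (F : closedFieldType) (A B : {poly F}) (zs : seq F) :
    B \is monic -> uniq zs -> (forall z, z \in zs <-> root B z) ->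
  \sum_(z <- zs) residue A B z = (A %% B)`_(size B).-2.
Proof.
move=> monB uzs zsP; have B0 := monic_neq0 monB.
pose T p := \sum_(z <- zs) residue p B z = p`_(size B).-2.
have TP a p q : T p -> T q -> T (a *: p + q).
  rewrite /T coefD coefZ => <- <-; rewrite mulr_sumr -big_split /=.
  by apply: eq_bigr => z _; rewrite residueP.
have dvd_res p z : B %| p -> residue p B z = 0.
  by move=> Bp; apply/residue_dvd/(dvdp_trans _ Bp); rewrite -mup_geq.
have -> : \sum_(z <- zs) residue A B z = \sum_(z <- zs) residue (A %% B) B z.
  apply: eq_bigr => z _; rewrite {1}(divp_eq A B) -[_ * B]scale1r residueP.
  by rewrite dvd_res ?mulr0 ?add0r // dvdp_mull.
apply: (partial_fraction_ind _ B T) => //; last by rewrite ltn_modp.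
  rewrite /T coef0 big1 // => z _; exact: dvd_res.
move=> z m hm; rewrite /T.
have zzs : z \in zs.
  by apply/zsP; rewrite root_factor_theorem XsubC_dvd // (leq_ltn_trans _ hm).
have e0 : ('X - z%:P) ^+ m.+1 != 0 by rewrite expf_neq0 // polyXsubC_eq0.
have : ('X - z%:P) ^+ m.+1 %| B by rewrite -mup_geq.
move=> /dvdpP[E BE].
have EE : B %/ ('X - z%:P) ^+ m.+1 = E by rewrite BE mulpK.
rewrite (bigD1_seq z) //= residue_simple // big1 => [|w wz]; last first.
  apply: residue_dvd; rewrite EE.
  have : ('X - w%:P) ^+ mup w B %| B by rewrite -mup_geq.
  rewrite {2}BE Gauss_dvdpl // coprimep_expl // coprimep_expr //.
  by rewrite coprimep_XsubC root_XsubC eq_sym.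
have monE : E \is monic by move: monB; rewrite BE monicMr // monic_exp // monicXsubC.
have sB : size B = (size E + m.+1)%N.
  by rewrite BE size_mul ?(monic_neq0 monE) // size_exp_XsubC addnS.
rewrite EE addr0 sB addnS /=; case: m {hm e0 BE EE} sB => [|m] sB.
  by rewrite addn0; move: monE; rewrite monicE => /eqP.
by rewrite addnS /= nth_default // leq_addr.
Qed.

(** * Change of coefficients from the integers *)

Lemma toQX : toQ 'X = 'X. Proof. exact: map_polyX. Qed.
Lemma toQC (c : int) : toQ c%:P = (c%:~R)%:P. Proof. exact: map_polyC. Qed.
Lemma toQM (p q : {poly int}) : toQ (p * q) = toQ p * toQ q. Proof. exact: rmorphM. Qed.
Lemma toQD (p q : {poly int}) : toQ (p + q) = toQ p + toQ q. Proof. exact: rmorphD. Qed.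
Lemma toQ1 : toQ 1 = 1. Proof. exact: rmorph1. Qed.

Lemma toC_ratr (p : {poly int}) : toC p = map_poly ratr (toQ p).
Proof.
rewrite /toC /toQ -map_poly_comp_id0 ?ratr_int //; last by rewrite rmorph0.
by apply: eq_map_poly => z /=; rewrite ratr_int.
Qed.

(** * Signs of quantum integers *)

(* The standard library parses the arguments of [sin] and [cos] in its own
   [R_scope]. *)
Local Arguments sin _%_ring_scope.
Local Arguments cos _%_ring_scope.

Lemma sin_addn_pi (k : nat) (x : R) : sin (k%:R * PI + x) = (-1) ^+ k * sin x.
Proof.
elim: k => [|k IHk]; first by rewrite mulr0n mul0r add0r expr0 mul1r.
have -> : k.+1%:R * PI + x = Rplus (k%:R * PI + x) PI.
  by rewrite RplusE -natr1 mulrDl mul1r addrAC.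
by rewrite neg_sin IHk exprS mulN1r mulNr.
Qed.

Lemma sin_four_term (a b c : R) :
  sin (a + b + c) * sin a + sin b * sin c = sin (a + b) * sin (a + c).
Proof.
(* After expansion by the addition formulas the identity holds modulo this relation. *)
have h : sin a ^+ 2 = 1 - cos a ^+ 2.
  by apply/eqP; rewrite eq_sym subr_eq eq_sym; apply/eqP; have := sin2_cos2 a.
by rewrite !sinD !cosD; ring: h.
Qed.

Section Roots.
Variables r s : nat.
Hypotheses (s_odd : odd s) (co_rs : coprime r s) (s_bnd : (0 < s < r)%N).

Let r_gt0 : (0 < r)%N. Proof. by case/andP: s_bnd; lia. Qed.
Let rR_gt0 : 0 < r%:R :> R. Proof. by rewrite ltr0n. Qed.
Let PI_gt0 : 0 < PI. Proof. exact/RltP/PI_RGT_0. Qed.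

Lemma sin_frac_gt0 (m : nat) : (0 < m < r)%N -> 0 < sin (m%:R * PI / r%:R).
Proof.
case/andP=> m0 mr; apply/RltP; apply: sin_gt_0; apply/RltP.
  by rewrite divr_gt0 // mulr_gt0 // ltr0n.
by rewrite ltr_pdivrMr // mulrC ltr_pM2l // ltr_nat.
Qed.

Lemma sin_frac_neq0 (n : nat) : (0 < n < r)%N -> sin (n%:R * PI * s%:R / r%:R) != 0.
Proof.
case/andP=> n0 nr.
(* Integer multiples of [PI] only change the sign, so [n * s] may be reduced modulo [r]; coprimality
   and [0 < n < r] keep the remainder nonzero. *)
have -> : n%:R * PI * s%:R / r%:R
    = ((n * s) %/ r)%:R * PI + ((n * s) %% r)%:R * PI / r%:R.
  have : (n * s)%:R = ((n * s) %/ r * r + (n * s) %% r)%:R :> R by rewrite -divn_eq.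
  rewrite natrD !natrM => h; field: h; exact: lt0r_neq0.
rewrite sin_addn_pi mulf_neq0 ?signr_eq0 // gt_eqF // sin_frac_gt0 //.
rewrite ltn_pmod // andbT lt0n; apply: contraL nr => /eqP nsr.
by rewrite -leqNgt dvdn_leq // -(Gauss_dvdl n co_rs) /dvdn nsr.
Qed.

Lemma qint_neq0 (n : nat) : (0 < n < r)%N -> qint r s n != 0.
Proof.
move=> hn; rewrite /qint ?RdivE ?RmultE mulf_neq0 ?sin_frac_neq0 // invr_eq0.
by have := sin_frac_gt0 s s_bnd; rewrite [s%:R * PI]mulrC => /gt_eqF ->.
Qed.

Lemma qint1 : qint r s 1 = 1.
Proof.
rewrite /qint ?RdivE ?RmultE mul1r divff //.
by have := sin_frac_gt0 s s_bnd; rewrite [s%:R * PI]mulrC => /gt_eqF ->.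
Qed.

Lemma qint0 : qint r s 0 = 0.
Proof. by rewrite /qint ?RdivE ?RmultE mulr0n !mul0r sin_0 mul0r. Qed.

Lemma qint_subr (n : nat) : (n <= r)%N -> qint r s (r - n) = qint r s n.
Proof.
move=> nr; rewrite /qint !RdivE !RmultE; congr (_ / _).
have -> : (r - n)%:R * PI * s%:R / r%:R = s%:R * PI + - (n%:R * PI * s%:R / r%:R).
  by rewrite natrB //; field; exact: lt0r_neq0.
by rewrite sin_addn_pi -RoppE sin_neg -signr_odd s_odd RoppE expr1 mulrNN mul1r.
Qed.

Lemma qint_four_term (a b c : nat) :
  qint r s (a + b + c) * qint r s a + qint r s b * qint r s c
  = qint r s (a + b) * qint r s (a + c).
Proof.
rewrite /qint !RdivE !RmultE !natrD !mulrDl.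
set d := sin (PI * s%:R / r%:R).
by rewrite !(mulrACA _ d^-1) -[LHS]mulrDl sin_four_term.
Qed.

(** The hypothesis says that the two summands in [qint_four_term] have the same sign, so their sum
    has it too. *)
Lemma eps_four_term (a b c : nat) :
  eps r s (a + b + c) * eps r s a = eps r s b * eps r s c ->
  eps r s (a + b) * eps r s (a + c) = eps r s b * eps r s c.
Proof.
rewrite /eps -!sgzM -qint_four_term => h.
case: (ltrgt0P (qint r s b * qint r s c)) h => [p|p|->].
- rewrite (gtr0_sgz p) => /eqP; rewrite sgz_cp0 => q.
  by rewrite gtr0_sgz // addr_gt0.
- rewrite (ltr0_sgz p) => /eqP; rewrite sgz_cp0 => q.
  by rewrite ltr0_sgz // -oppr_gt0 opprD addr_gt0 // oppr_gt0.
by rewrite sgz0 => /eqP; rewrite sgz_eq0 => /eqP ->; rewrite addr0 sgz0.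
Qed.

Lemma eps_sq (n : nat) : (0 < n < r)%N -> eps r s n * eps r s n = 1.
Proof. by move=> /qint_neq0; rewrite /eps; case: sgzP => //. Qed.

Lemma eps_subr (n : nat) : (n <= r)%N -> eps r s (r - n) = eps r s n.
Proof. by move=> ?; rewrite /eps qint_subr. Qed.

Lemma eps0 : eps r s 0 = 0.
Proof. by rewrite /eps qint0 sgz0. Qed.

Lemma eps1 : eps r s 1 = 1.
Proof. by rewrite /eps qint1 sgz1. Qed.

Lemma pm1P (x : int) : x * x = 1 -> x = 1 \/ x = -1.
Proof. by move/eqP; rewrite -expr2 sqrf_eq1 => /orP[] /eqP; [left|right]. Qed.

(** Each hypothesis [x * x = 1] is split into [x = 1] and [x = -1]; an identity between signs is
    then left to [ring]. *)
Ltac case_signs :=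
  repeat match goal with
  | h : ?x * ?x = 1 |- _ =>
      let e := fresh in destruct (pm1P _ h) as [e|e]; rewrite ?e; clear h e
  end.

(** * Signs of the theta coefficients *)

Lemma sgzV (x : R) : sgz x^-1 = sgz x.
Proof.
case: (sgzP x) => [->|x0|x0].
- by rewrite invr0 sgz0.
- by rewrite gtr0_sgz ?invr_gt0.
by rewrite ltr0_sgz ?invr_lt0.
Qed.

Definition sgfact (n : nat) : int := sgz (qfact r s n).

Lemma sgfact0 : sgfact 0 = 1.
Proof. by rewrite /sgfact /qfact big_geq // sgz1. Qed.

Lemma sgfactS (n : nat) : sgfact n.+1 = sgfact n * eps r s n.+1.
Proof. by rewrite /sgfact /qfact big_nat_recr //= sgzM. Qed.

Lemma sgfact_sq (n : nat) : (n < r)%N -> sgfact n * sgfact n = 1.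
Proof.
elim: n => [|n IHn] hn; first by rewrite sgfact0.
by rewrite sgfactS mulrACA IHn ?eps_sq ?mulr1 // ltnW.
Qed.

(** Sign of [theta] in the parameters [a], [b], [c]; the denominator enters as a factor because a
    nonzero sign is its own inverse. *)
Definition sgtheta (a b c : nat) : int :=
  (-1) ^+ (a + b + c) *
  (sgfact (a + b + c).+1 * sgfact a * sgfact b * sgfact c) *
  (sgfact (a + b) * sgfact (a + c) * sgfact (b + c)).

Lemma omega_coef_sgtheta (a b c i j k : nat) :
    i = (b + c)%N -> j = (a + c)%N -> k = (a + b)%N -> (a + b + c <= r - 2)%N ->
  omega_coef r s i j k = (sgtheta a b c)%:~R.
Proof.
move=> -> -> -> abc; rewrite /omega_coef.
have -> : admissible r (b + c) (a + c) (a + b) by rewrite /admissible; lia.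
rewrite /theta.
have -> : ((a + c + (a + b) - (b + c)) %/ 2 = a)%N by lia.
have -> : ((b + c + (a + b) - (a + c)) %/ 2 = b)%N by lia.
have -> : ((b + c + (a + c) - (a + b)) %/ 2 = c)%N by lia.
by rewrite sgzM sgzM sgzV sgzX sgzN1 !sgzM addn1.
Qed.

Lemma omega_coef_out (i j k : nat) : ~~ admissible r i j k -> omega_coef r s i j k = 0.
Proof. by rewrite /omega_coef => /negbTE ->. Qed.

(** Coefficient of the recurrence for [Ppoly]. It vanishes at index 0, which removes the spurious
    terms with label [0.-1 = 0]. *)
Definition sgpair (n : nat) : rat := (eps r s n * eps r s n.+1)%:~R.

Lemma sgpair0 : sgpair 0 = 0.
Proof. by rewrite /sgpair eps0 mul0r. Qed.

Lemma sgthetaCA (a b c : nat) : sgtheta a b c = sgtheta b a c.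
Proof. by rewrite /sgtheta (addnC a b); ring. Qed.

Lemma sgthetaAC (a b c : nat) : sgtheta a b c = sgtheta a c b.
Proof. by rewrite /sgtheta (addnAC a b) (addnC b c); ring. Qed.

(** With one parameter zero the factorials pair off and only the sign of [[a + b + 1]] is left. *)
Lemma sgtheta0 (a b : nat) : (a + b < r)%N ->
  sgtheta a b 0 = (-1) ^+ (a + b) * eps r s (a + b).+1.
Proof.
move=> ab; rewrite /sgtheta !addn0 sgfact0 sgfactS.
have ha : sgfact a * sgfact a = 1 by rewrite sgfact_sq //; lia.
have hb : sgfact b * sgfact b = 1 by rewrite sgfact_sq //; lia.
have hab : sgfact (a + b) * sgfact (a + b) = 1 by rewrite sgfact_sq.
by case_signs; ring.
Qed.

(* Associativity for the four labels [1, j, i, l]; each side is a sum over an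
   intermediate label. With [A + B = l + 1], [A + C = j + 1], [B + C = i + 1] the
   ratios of the four thetas to a common factor are single quantum integers, and
   the identity reduces to the signs in [qint_four_term]. *)
Lemma omega_coef_assoc (i j l : nat) : (i < r - 1)%N -> (j < r - 1)%N -> (l < r - 1)%N ->
  omega_coef r s j i l.+1 - sgpair l * omega_coef r s j i l.-1
  = omega_coef r s j.+1 i l - sgpair j * omega_coef r s j.-1 i l.
Proof.
move=> hi hj hl.
have out x y z : ~~ admissible r x y z -> omega_coef r s x y z = 0.
  exact: omega_coef_out.
(* Outside these parity and triangle conditions all four terms vanish. *)
have [h|] := boolP [&& odd (i + j + l), i <= j + l + 1, j <= i + l + 1 & l <= i + j + 1]%N;
  last first.
  move=> h; rewrite !(out j.+1, out j i l.+1); try by rewrite /admissible; lia.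
  case: l hl h => [|l] hl h; case: j hj h => [|j] hj h;
    rewrite ?sgpair0 ?mul0r // ?out ?mulr0 //= /admissible; lia.
have [A [B [C [hA hB hC]]]] : exists A B C : nat,
    [/\ A + B = l.+1, A + C = j.+1 & B + C = i.+1]%N.
  exists ((j + l + 1 - i) %/ 2)%N, ((i + l + 1 - j) %/ 2)%N, ((i + j + 1 - l) %/ 2)%N.
  by split; lia.
(* [A = 0] means [i = j + l + 1]: only the two terms with a raised label survive. *)
case: A hA hB => [|a] hA hB.
- rewrite (_ : sgpair l * _ = 0); last first.
    by case: l hl hA h => [|l] *; rewrite ?sgpair0 ?mul0r // out ?mulr0 //= /admissible; lia.
  rewrite (_ : sgpair j * _ = 0); last first.
    by case: j hj hB h => [|j] *; rewrite ?sgpair0 ?mul0r // out ?mulr0 //= /admissible; lia.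
  case: B hC hA => [|b] hC hA; first by lia.
  case: C hC hB => [|c] hC hB; first by lia.
  rewrite (omega_coef_sgtheta b.+1 0 c _ _ _); try lia.
  rewrite (omega_coef_sgtheta b 0 c.+1 _ _ _); try lia.
  rewrite !(sgthetaAC _ 0) !sgtheta0; try lia.
  by rewrite addSnnS.
(* [B = 0] means [j = i + l + 1]: the terms with [l + 1] and [j - 1] survive. The case [C = 0] below
   is its mirror image. *)
case: B hA hC => [|b] hA hC.
- rewrite (out j.+1); last by rewrite /admissible; lia.
  rewrite (_ : sgpair l * _ = 0); last first.
    by case: l hl hA h => [|l] *; rewrite ?sgpair0 ?mul0r // out ?mulr0 //= /admissible; lia.
  case: C hC hB => [|c] hC hB; first by lia.
  rewrite (omega_coef_sgtheta 0 a.+1 c _ _ _); try lia.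
  rewrite (omega_coef_sgtheta 0 a c _ _ _); try lia.
  rewrite !(sgthetaCA 0) !(sgthetaAC _ 0) !sgtheta0; try lia.
  rewrite (_ : j = (a + c).+1); last by lia.
  rewrite /sgpair subr0 sub0r -intrM -intrN; congr (_%:~R).
  have h1 : eps r s (a + c).+1 * eps r s (a + c).+1 = 1 by rewrite eps_sq //; lia.
  by rewrite addSn exprS; case_signs; ring.
case: C hC hB => [|c] hC hB.
- rewrite (out j i l.+1); last by rewrite /admissible; lia.
  rewrite (_ : sgpair j * _ = 0); last first.
    by case: j hj hB h => [|j] *; rewrite ?sgpair0 ?mul0r // out ?mulr0 //= /admissible; lia.
  rewrite (omega_coef_sgtheta b a 0 _ _ _); try lia.
  rewrite (omega_coef_sgtheta b a.+1 0 _ _ _); try lia.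
  rewrite !sgtheta0; try lia.
  rewrite (_ : l = (b + a).+1); last by lia.
  rewrite /sgpair subr0 sub0r -intrM -intrN; congr (_%:~R).
  have h1 : eps r s (b + a).+1 * eps r s (b + a).+1 = 1 by rewrite eps_sq //; lia.
  by rewrite addnS exprS; case_signs; ring.
have ej : j = (a + c).+1 by lia.
have ei : i = (b + c).+1 by lia.
have el : l = (a + b).+1 by lia.
subst i j l => {hA hB hC h} /=.
(* Half the label sum is [a + b + c + 1] for the lowered triples and [a + b + c + 2] for the raised
   ones; admissibility bounds it by [r - 2]. *)
have [big|small] := ltnP r (a + b + c).+3.
  by rewrite !out ?mulr0 // /admissible; lia.
rewrite (omega_coef_sgtheta b a c.+1 (a + c).+1 (b + c).+1 (a + b)); try lia.
rewrite (omega_coef_sgtheta b.+1 a c (a + c) (b + c).+1 (a + b).+1); try lia.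
set K := (-1) ^+ (a + b + c) *
  (sgfact (a + b + c).+2 * sgfact a * sgfact b * sgfact c) *
  (sgfact (a + b).+1 * sgfact (a + c).+1 * sgfact (b + c).+1).
have T2 : sgtheta b a c.+1 = - (K * eps r s c.+1 * eps r s (a + b).+1).
  rewrite /sgtheta /K.
  have -> : (b + a + c.+1 = (a + b + c).+1)%N by lia.
  have -> : (b + c.+1 = (b + c).+1)%N by lia.
  have -> : (a + c.+1 = (a + c).+1)%N by lia.
  have -> : (b + a = a + b)%N by lia.
  have h1 : eps r s (a + b).+1 * eps r s (a + b).+1 = 1 by rewrite eps_sq //; lia.
  by rewrite exprS (sgfactS c) (sgfactS (a + b)); case_signs; ring.
have T4 : sgtheta b.+1 a c = - (K * eps r s b.+1 * eps r s (a + c).+1).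
  rewrite /sgtheta /K.
  have -> : (b.+1 + a + c = (a + b + c).+1)%N by lia.
  have -> : (b.+1 + a = (a + b).+1)%N by lia.
  have -> : (b.+1 + c = (b + c).+1)%N by lia.
  have h1 : eps r s (a + c).+1 * eps r s (a + c).+1 = 1 by rewrite eps_sq //; lia.
  by rewrite exprS (sgfactS b) (sgfactS (a + c)); case_signs; ring.
have eB : eps r s b.+1 * eps r s b.+1 = 1 by rewrite eps_sq //; lia.
have eC : eps r s c.+1 * eps r s c.+1 = 1 by rewrite eps_sq //; lia.
have el1 : eps r s (a + b).+1 * eps r s (a + b).+1 = 1 by rewrite eps_sq //; lia.
have ej1 : eps r s (a + c).+1 * eps r s (a + c).+1 = 1 by rewrite eps_sq //; lia.
rewrite T2 T4 /sgpair -!intrM.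
(* At [r = a + b + c + 3] the raised triples drop out, and [eps_n = eps_(r-n)] matches the two
   lowered terms. *)
move: small; rewrite leq_eqVlt => /orP[/eqP top|small].
- rewrite !out ?sub0r; try by rewrite /admissible; lia.
  rewrite -!intrN; congr (_%:~R).
  have e1 : eps r s (a + b).+2 = eps r s c.+1.
    by rewrite -(eps_subr c.+1); [congr eps; lia|lia].
  have e2 : eps r s (a + c).+2 = eps r s b.+1.
    by rewrite -(eps_subr b.+1); [congr eps; lia|lia].
  by rewrite e1 e2; case_signs; ring.
rewrite (omega_coef_sgtheta b.+1 a.+1 c (a + c).+1 (b + c).+1 (a + b).+2); try lia.
rewrite (omega_coef_sgtheta b a.+1 c.+1 (a + c).+2 (b + c).+1 (a + b).+1); try lia.
rewrite -!intrB; congr (_%:~R).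
have T1 : sgtheta b.+1 a.+1 c
    = K * eps r s (a + b + c).+3 * eps r s a.+1 * eps r s b.+1 * eps r s (a + b).+2.
  rewrite /sgtheta /K.
  have -> : (b.+1 + a.+1 + c = (a + b + c).+2)%N by lia.
  have -> : (b.+1 + a.+1 = (a + b).+2)%N by lia.
  have -> : (b.+1 + c = (b + c).+1)%N by lia.
  have -> : (a.+1 + c = (a + c).+1)%N by lia.
  rewrite !exprS (sgfactS b) (sgfactS a) (sgfactS (a + b).+1) (sgfactS (a + b + c).+2).
  by ring.
have T3 : sgtheta b a.+1 c.+1
    = K * eps r s (a + b + c).+3 * eps r s a.+1 * eps r s c.+1 * eps r s (a + c).+2.
  rewrite /sgtheta /K.
  have -> : (b + a.+1 + c.+1 = (a + b + c).+2)%N by lia.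
  have -> : (b + a.+1 = (a + b).+1)%N by lia.
  have -> : (b + c.+1 = (b + c).+1)%N by lia.
  have -> : (a.+1 + c.+1 = (a + c).+2)%N by lia.
  rewrite !exprS (sgfactS c) (sgfactS a) (sgfactS (a + c).+1) (sgfactS (a + b + c).+2).
  by ring.
rewrite T1 T3.
have eA : eps r s a.+1 * eps r s a.+1 = 1 by rewrite eps_sq //; lia.
have eS : eps r s (a + b + c).+3 * eps r s (a + b + c).+3 = 1 by rewrite eps_sq //; lia.
have el2 : eps r s (a + b).+2 * eps r s (a + b).+2 = 1 by rewrite eps_sq //; lia.
have ej2 : eps r s (a + c).+2 * eps r s (a + c).+2 = 1 by rewrite eps_sq //; lia.
have := eps_four_term a.+1 b.+1 c.+1.
have -> : (a.+1 + b.+1 + c.+1 = (a + b + c).+3)%N by lia.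
have -> : (a.+1 + b.+1 = (a + b).+2)%N by lia.
have -> : (a.+1 + c.+1 = (a + c).+2)%N by lia.
(* If [x * y = - (u * v)], both sides of the conclusion vanish; if [x * y = u * v], they are [2 w v]
   and [2 z u], equal because [w * z = u * v]. *)
suff H (x y u v w z : int) : x * x = 1 -> y * y = 1 -> u * u = 1 -> v * v = 1 ->
    w * w = 1 -> z * z = 1 -> (x * y = u * v -> w * z = u * v) ->
    x * y * u * w + w * v = x * y * v * z + z * u.
  move=> /(H _ _ _ _ _ _ eS eA eB eC el2 ej2) /eqP; rewrite -subr_eq0 => /eqP {}H.
  apply/eqP; rewrite -subr_eq0; apply/eqP; rewrite -[RHS](mulr0 K) -[in RHS]H.
  clear eS eA eB eC el2 ej2 H T1 T2 T3 T4.
  by case_signs; ring.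
by move=> /pm1P[]-> /pm1P[]-> /pm1P[]-> /pm1P[]-> /pm1P[]-> /pm1P[]-> // /(_ erefl).
Qed.

(** * The algebra V_q *)

Hypotheses (r_ge3 : (3 <= r)%N) (r_odd : odd r).

Local Notation n := (r - 1)%N.
Local Notation W := (omega_coef r s).
Local Notation e := (ebasis r).
Local Notation eta_d := (eta_diag r s).

Lemma omega_coef_ge1 (i j k : nat) : (n <= i)%N -> W i j k = 0.
Proof. by move=> h; apply: omega_coef_out; rewrite /admissible; lia. Qed.

Lemma omega_coef_ge2 (i j k : nat) : (n <= j)%N -> W i j k = 0.
Proof. by move=> h; apply: omega_coef_out; rewrite /admissible; lia. Qed.

Lemma omega_coef_ge3 (i j k : nat) : (n <= k)%N -> W i j k = 0.
Proof. by move=> h; apply: omega_coef_out; rewrite /admissible; lia. Qed.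

Lemma eta_diag_sq (k : nat) : (k < n)%N -> eta_d k * eta_d k = 1.
Proof.
move=> hk; rewrite /eta_diag mulrACA -expr2 sqrr_sign mul1r -intrM.
by rewrite eps_sq //; lia.
Qed.

Lemma eta_diagS (k : nat) : (k.+1 < n)%N -> eta_d k.+1 = - sgpair k.+1 * eta_d k.
Proof.
move=> hk; rewrite /eta_diag /sgpair !intrM exprS.
have h : (eps r s k.+1)%:~R * (eps r s k.+1)%:~R = 1 :> rat by rewrite -intrM eps_sq //; lia.
by rewrite -[LHS]mulr1 -[X in _ * X = _]h; ring.
Qed.

Lemma sgpair_sq (k : nat) : (k.+1 < n)%N -> sgpair k.+1 * sgpair k.+1 = 1.
Proof.
by move=> hk; rewrite /sgpair -intrM mulrACA !eps_sq //; lia.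
Qed.

Lemma sum_delta (m l : nat) (z : nat -> rat) :
  \sum_(k < m) z k * (k == l :> nat)%:R = if (l < m)%N then z l else 0.
Proof.
case: ifP => [h|h].
  rewrite (bigD1 (Ordinal h)) //= eqxx mulr1 big1 ?addr0 // => k hk.
  rewrite (_ : (k == l :> nat) = false) ?mulr0 //.
  by apply: contraNF hk => /eqP ?; apply/eqP/val_inj.
rewrite big1 // => k _; case: eqP => [kl|]; last by rewrite mulr0.
by have := ltn_ord k; rewrite kl h.
Qed.

Lemma ebasisE (i : nat) (k : 'I_n) : e i 0 k = (k == i :> nat)%:R.
Proof. by rewrite mxE. Qed.

Lemma eta_ebasis (k : nat) : (k < n)%N -> Defs.eta r s (e k) (e k) = eta_d k.
Proof.
move=> hk; rewrite /Defs.eta (eq_bigr (fun i : 'I_n => eta_d i * (i == k :> nat)%:R)).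
  by rewrite sum_delta hk.
by move=> i _; rewrite ebasisE -natrM mulnb andbb mulrC.
Qed.

Lemma vmulE (x y : Vq r) (k : 'I_n) :
  vmul r s x y 0 k = eta_d k * \sum_(i < n) \sum_(j < n) x 0 i * y 0 j * W i j k.
Proof.
rewrite mxE eta_ebasis // mulrC; congr (_ * _).
  apply: (mulfI (x := eta_d k)); last rewrite divff ?eta_diag_sq //.
    by apply: contra_eqN (eta_diag_sq k (ltn_ord k)) => /eqP ->; rewrite mul0r eq_sym oner_eq0.
  by apply: contra_eqN (eta_diag_sq k (ltn_ord k)) => /eqP ->; rewrite mul0r eq_sym oner_eq0.
apply: eq_bigr => i _; apply: eq_bigr => j _.
rewrite (eq_bigr (fun l : 'I_n => x 0 i * y 0 j * W i j l * (l == k :> nat)%:R)).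
  by rewrite (sum_delta n k (fun l => x 0 i * y 0 j * W i j l)) ltn_ord.
by move=> l _; rewrite ebasisE; ring.
Qed.

Lemma vmulPl (a : rat) (x x' y : Vq r) :
  vmul r s (a *: x + x') y = a *: vmul r s x y + vmul r s x' y.
Proof.
apply/rowP => k; rewrite [RHS]mxE [X in _ = X + _]mxE !vmulE mulrCA -mulrDr.
congr (_ * _); rewrite mulr_sumr -big_split; apply: eq_bigr => i _ /=.
rewrite mulr_sumr -big_split; apply: eq_bigr => j _ /=.
by rewrite !mxE; ring.
Qed.

Lemma vmulPr (a : rat) (x y y' : Vq r) :
  vmul r s x (a *: y + y') = a *: vmul r s x y + vmul r s x y'.
Proof.
apply/rowP => k; rewrite [RHS]mxE [X in _ = X + _]mxE !vmulE mulrCA -mulrDr.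
congr (_ * _); rewrite mulr_sumr -big_split; apply: eq_bigr => i _ /=.
rewrite mulr_sumr -big_split; apply: eq_bigr => j _ /=.
by rewrite !mxE; ring.
Qed.

Lemma vmul0r (y : Vq r) : vmul r s 0 y = 0.
Proof. by have := vmulPl (-1) 0 0 y; rewrite scaler0 addr0 scaleN1r addNr. Qed.

Lemma vmulr0 (x : Vq r) : vmul r s x 0 = 0.
Proof. by have := vmulPr (-1) x 0 0; rewrite scaler0 addr0 scaleN1r addNr. Qed.

Lemma vmul_suml (m : nat) (a : 'I_m -> rat) (u : 'I_m -> Vq r) (y : Vq r) :
  vmul r s (\sum_i a i *: u i) y = \sum_i a i *: vmul r s (u i) y.
Proof.
apply: (big_rec2 (fun u v => vmul r s u y = v)) => [|i u' v _ <-]; first exact: vmul0r.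
exact: vmulPl.
Qed.

Lemma vmul_sumr (m : nat) (a : 'I_m -> rat) (u : 'I_m -> Vq r) (x : Vq r) :
  vmul r s x (\sum_i a i *: u i) = \sum_i a i *: vmul r s x (u i).
Proof.
apply: (big_rec2 (fun u v => vmul r s x u = v)) => [|i u' v _ <-]; first exact: vmulr0.
exact: vmulPr.
Qed.

Lemma ebasis_sum (x : Vq r) : x = \sum_(i < n) x 0 i *: e i.
Proof.
apply/rowP => k; rewrite summxE (bigD1 k) //= !mxE eqxx mulr1 big1 ?addr0 // => i ik.
by rewrite !mxE (_ : (k == i :> nat) = false) ?mulr0 // eq_sym; apply/negbTE.
Qed.

Lemma ebasis_ge (i : nat) : (n <= i)%N -> e i = 0.
Proof.
move=> h; apply/rowP => k; rewrite !mxE; case: eqP => // ki.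
by have := ltn_ord k; rewrite ki ltnNge h.
Qed.

Lemma vmul_ebasisl (i : nat) (y : Vq r) (k : 'I_n) : (i < n)%N ->
  vmul r s (e i) y 0 k = eta_d k * \sum_(j < n) y 0 j * W i j k.
Proof.
move=> hi; rewrite vmulE (bigD1 (Ordinal hi)) //= [X in _ + X]big1 ?addr0.
  by congr (_ * _); apply: eq_bigr => j _; rewrite ebasisE eqxx mul1r.
move=> l hl; rewrite big1 // => j _; rewrite ebasisE (_ : (l == i :> nat) = false).
  by rewrite !mul0r.
by apply/negbTE.
Qed.

Lemma vmul_ebasis (i j : nat) (k : 'I_n) : vmul r s (e i) (e j) 0 k = eta_d k * W i j k.
Proof.
have [hi|hi] := leqP n i.
  by rewrite ebasis_ge // omega_coef_ge1 // mulr0 vmulE big1 ?mulr0 // => l _;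
     rewrite big1 // => m _; rewrite mxE !mul0r.
rewrite vmul_ebasisl //; congr (_ * _).
rewrite (eq_bigr (fun l : 'I_n => W i l k * (l == j :> nat)%:R)).
  by rewrite (sum_delta n j (fun l => W i l k)); case: ltnP => // h; rewrite omega_coef_ge2.
by move=> l _; rewrite ebasisE mulrC.
Qed.

Lemma vmul_unit_ebasis (j : nat) : (j < n)%N -> vmul r s (e 0) (e j) = e j.
Proof.
move=> hj; apply/rowP => k; rewrite vmul_ebasis ebasisE; have hk := ltn_ord k.
case: eqP => [->|jk]; last by rewrite omega_coef_out ?mulr0 // /admissible; lia.
rewrite (omega_coef_sgtheta j 0 0) ?addn0 //; last by lia.
rewrite sgtheta0 ?addn0; last by lia.
by rewrite intrM rmorphXn /= intrN -/(eta_d j) eta_diag_sq.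
Qed.

Lemma vmul_unit (y : Vq r) : vmul r s (e 0) y = y.
Proof.
rewrite {1}(ebasis_sum y) vmul_sumr [RHS]ebasis_sum.
by apply: eq_bigr => j _; rewrite vmul_unit_ebasis.
Qed.

(** Only [j - 1] and [j + 1] can be admissible with [1] and [j]. Both ends are covered:
    [sgpair 0 = 0] at the bottom, [e n = 0] at the top. *)
Lemma vmul1_ebasis (j : nat) : (j < n)%N ->
  vmul r s (e 1) (e j) = e j.+1 - sgpair j *: e j.-1.
Proof.
move=> hj; apply/rowP => k; rewrite vmul_ebasis !mxE; have hk := ltn_ord k.
have [kj|kj] := eqVneq (k : nat) j.+1.
  rewrite kj (_ : (j.+1 == j.-1) = false) ?mulr0 ?subr0; last by lia.
  rewrite (omega_coef_sgtheta j 1 0); try lia.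
  rewrite sgtheta0 ?addn1; last by lia.
  by rewrite intrM rmorphXn /= intrN -/(eta_d j.+1) eta_diag_sq // -kj.
case: j hj kj => [|j] hj kj; last first.
  have [/= ->|kj'] := eqVneq (k : nat) j; last first.
    by rewrite mulr0 subr0 omega_coef_out ?mulr0 // /admissible; lia.
  rewrite (omega_coef_sgtheta j 0 1); try lia.
  rewrite sgthetaAC sgtheta0 ?addn1; last by lia.
  rewrite intrM rmorphXn /= intrN -/(eta_d j.+1) eta_diagS // mulr1 mulrCA.
  by rewrite eta_diag_sq; [ring|lia].
by rewrite sgpair0 mul0r subr0 omega_coef_out ?mulr0 // /admissible; lia.
Qed.

(** The condition on [z] settles the top coordinate, where [l + 1 = n]; the factor [(0 < l)%:R]
    corrects [0.-1 = 0] at the bottom. *)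
Lemma vmul1_coord (z : nat -> rat) (l : 'I_n) : (forall k, (n <= k)%N -> z k = 0) ->
  vmul r s (e 1) (\sum_(k < n) z k *: e k) 0 l
  = (0 < l)%:R * z l.-1 - sgpair l.+1 * z l.+1.
Proof.
move=> z0; rewrite vmul_sumr summxE; have hl := ltn_ord l.
rewrite (eq_bigr (fun k : 'I_n => (0 < l)%:R * z k * (k == l.-1 :> nat)%:R
    + - (sgpair k * z k) * (k == l.+1 :> nat)%:R)); last first.
  move=> k _; rewrite vmul1_ebasis // !mxE mulrBr mulNr !mulrA [z k * sgpair k]mulrC.
  congr (_ - _).
    by rewrite [_ * z k]mulrC -mulrA -natrM mulnb; congr (_ * (nat_of_bool _)%:R); lia.
  have [k0|k0] := posnP k; first by rewrite k0 sgpair0 !mul0r.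
  by congr (_ * (nat_of_bool _)%:R); lia.
rewrite big_split /= (sum_delta n l.-1 (fun k => (0 < l)%:R * z k)).
rewrite (sum_delta n l.+1 (fun k => - (sgpair k * z k))).
rewrite (leq_ltn_trans (leq_pred _)) //; congr (_ + _).
by case: ltnP => // h; rewrite z0 // mulr0 oppr0.
Qed.

(** In coordinates this is [omega_coef_assoc], once [eta_diagS] has converted the factors [eta_d] at
    [l - 1] and [l + 1] into [eta_d l]. *)
Lemma vmul1A_ebasis (j i : nat) : (j < n)%N -> (i < n)%N ->
  vmul r s (e 1) (vmul r s (e j) (e i)) = vmul r s (vmul r s (e 1) (e j)) (e i).
Proof.
move=> hj hi; apply/rowP => l; have hl := ltn_ord l.
have -> : vmul r s (e j) (e i) = \sum_(k < n) (eta_d k * W j i k) *: e k.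
  by rewrite {1}[LHS]ebasis_sum; apply: eq_bigr => k _; rewrite vmul_ebasis.
rewrite (vmul1_coord (fun k => eta_d k * W j i k)); last first.
  by move=> k hk; rewrite omega_coef_ge3 ?mulr0.
rewrite vmul1_ebasis // [X in vmul r s X]addrC -scaleNr vmulPl.
rewrite [RHS]mxE [X in _ = X + _]mxE !vmul_ebasis.
transitivity (eta_d l * (W j.+1 i l - sgpair j * W j.-1 i l)); last by ring.
rewrite -omega_coef_assoc //.
have -> : sgpair l.+1 * (eta_d l.+1 * W j i l.+1) = - (eta_d l * W j i l.+1).
  have [hl1|hl1] := ltnP l.+1 n; last by rewrite omega_coef_ge3 // !mulr0 oppr0.
  by rewrite eta_diagS // !mulNr mulrN 2!mulrA sgpair_sq // mul1r.
have -> : (0 < l)%:R * (eta_d l.-1 * W j i l.-1) = - (eta_d l * sgpair l * W j i l.-1).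
  case: (nat_of_ord l) hl => [|m] hm /=; first by rewrite sgpair0 mulr0 !mul0r oppr0.
  rewrite mul1r eta_diagS // -mulNr; congr (_ * _).
  by rewrite mulrAC !mulNr opprK sgpair_sq // mul1r.
by ring.
Qed.

Lemma vmul1A (x y : Vq r) : vmul r s (e 1) (vmul r s x y) = vmul r s (vmul r s (e 1) x) y.
Proof.
rewrite (ebasis_sum x) !vmul_suml !vmul_sumr vmul_suml; apply: eq_bigr => j _; congr (_ *: _).
rewrite (ebasis_sum y) !vmul_sumr; apply: eq_bigr => i _; congr (_ *: _).
exact: vmul1A_ebasis.
Qed.

(** * Evaluation of polynomials in the algebra *)

Lemma vevalE (m : nat) (f : {poly rat}) (x : Vq r) : (size f <= m)%N ->
  veval r s f x = \sum_(i < m) f`_i *: vpow r s x i.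
Proof.
move=> hm; rewrite /veval (big_ord_widen m (fun i => f`_i *: vpow r s x i)) //.
rewrite big_mkcond; apply: eq_bigr => i _; case: ltnP => // h.
by rewrite nth_default // scale0r.
Qed.

Lemma vevalP (a : rat) (f g : {poly rat}) (x : Vq r) :
  veval r s (a *: f + g) x = a *: veval r s f x + veval r s g x.
Proof.
pose m := maxn (size (a *: f + g)) (maxn (size f) (size g)).
rewrite !(@vevalE m); try by rewrite /m !leq_max leqnn ?orbT.
rewrite scaler_sumr -big_split; apply: eq_bigr => i _ /=.
by rewrite coefD coefZ scalerDl scalerA.
Qed.

Lemma veval0 (x : Vq r) : veval r s 0 x = 0.
Proof. by rewrite /veval size_poly0 big_ord0. Qed.

Lemma veval1 (x : Vq r) : veval r s 1 x = e 0.
Proof. by rewrite /veval size_poly1 big_ord1 coef1 scale1r. Qed.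

Lemma vevalXM (f : {poly rat}) (x : Vq r) :
  veval r s ('X * f) x = vmul r s x (veval r s f x).
Proof.
rewrite (@vevalE (size f).+1) ?(leq_trans (size_polyMleq _ _)) ?size_polyX //.
rewrite big_ord_recl coefXM scale0r add0r /veval vmul_sumr; apply: eq_bigr => i _.
by rewrite coefXM.
Qed.

(** Induction on [f] brings in one factor [e 1] at a time, which is the associativity of
    [vmul1A]. *)
Lemma veval_mul (f g : {poly rat}) :
  veval r s (f * g) (e 1) = vmul r s (veval r s f (e 1)) (veval r s g (e 1)).
Proof.
elim/poly_ind: f => [|f c IHf].
  by rewrite mul0r veval0 vmul0r.
have -> : (f * 'X + c%:P) * g = c *: g + 'X * (f * g).
  by rewrite -mul_polyC; ring.
have -> : f * 'X + c%:P = c *: 1 + 'X * f by rewrite -mul_polyC; ring.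
by rewrite !vevalP !vevalXM IHf vmulPl veval1 vmul_unit vmul1A.
Qed.

(** * The polynomials [P_k] and the presentation of the algebra *)

Local Notation P := (Ppoly r s).
Local Notation Q k := (toQ (Ppoly r s k)).

Lemma Ppoly0 : P 0 = 1. Proof. by []. Qed.
Lemma Ppoly1 : P 1 = 'X. Proof. by []. Qed.
Lemma PpolySS (k : nat) :
  P k.+2 = 'X * P k.+1 + (eps r s k.+1 * eps r s k.+2)%:P * P k.
Proof. by rewrite /Ppoly /=; case: (Ppair r s k). Qed.

Lemma size_monic_Ppoly (k : nat) : size (P k) = k.+1 /\ P k \is monic.
Proof.
have [//] : (size (P k) = k.+1 /\ P k \is monic) /\ (size (P k.+1) = k.+2 /\ P k.+1 \is monic).
elim: k => [|k [[s0 m0] [s1 m1]]].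
  by rewrite Ppoly0 Ppoly1 size_poly1 size_polyX monic1 monicX.
split=> //; rewrite PpolySS.
have sX : size ('X * P k.+1) = k.+3.
  by rewrite mulrC size_mulX ?s1 // -size_poly_gt0 s1.
have lt : (size ((eps r s k.+1 * eps r s k.+2)%:P * P k)%R < size ('X * P k.+1)%R)%N.
  by rewrite mul_polyC (leq_ltn_trans (size_scale_leq _ _)) // s0 sX.
rewrite size_polyDl // sX monicE lead_coefDl // -monicE; split=> //.
by rewrite monicMl ?monicX.
Qed.

Lemma QSS (k : nat) : Q k.+2 = 'X * Q k.+1 + sgpair k.+1 *: Q k.
Proof. by rewrite PpolySS toQD !toQM toQX toQC -mul_polyC. Qed.

Lemma size_Q (k : nat) : size (Q k) = k.+1.
Proof.
by rewrite /toQ size_map_inj_poly ?rmorph0 ?(size_monic_Ppoly k).1 //; exact: intr_inj.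
Qed.

Lemma Q_monic (k : nat) : Q k \is monic.
Proof. by rewrite /toQ monic_map // (size_monic_Ppoly k).2. Qed.

(** Both sides obey the same three-term recurrence. The range includes [k = n], where [e n = 0]:
    this is the relation [P_(r-1) (e_1) = 0]. *)
Lemma veval_Q (k : nat) : (k <= n)%N -> veval r s (Q k) (e 1) = e k.
Proof.
elim/ltn_ind: k => -[|[|k]] IH hk.
- by rewrite Ppoly0 toQ1 veval1.
- by rewrite Ppoly1 toQX -['X]mulr1 vevalXM veval1 vmul1_ebasis ?sgpair0 ?scale0r ?subr0 //; lia.
rewrite QSS addrC vevalP vevalXM !IH ?vmul1_ebasis //=; try lia.
by rewrite addrC subrK.
Qed.

Lemma Q_span (m : nat) (f : {poly rat}) : (size f <= m)%N ->
  exists c : nat -> rat, f = \sum_(i < m) c i *: Q i.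
Proof.
elim: m f => [|m IH] f hf.
  exists (fun=> 0); rewrite big_ord0; apply/eqP; rewrite -size_poly_eq0; lia.
have [|c hc] := IH (f - f`_m *: Q m).
  apply/leq_sizeP => j; rewrite leq_eqVlt coefB coefZ => /orP[/eqP <-|hj].
    by have := Q_monic m; rewrite monicE /lead_coef size_Q => /eqP /= ->; rewrite mulr1 subrr.
  rewrite [X in _ * X]nth_default ?size_Q // mulr0 subr0.
  by rewrite nth_default // (leq_trans hf).
exists (fun i => if i == m then f`_m else c i).
rewrite big_ord_recr /= eqxx -[LHS](subrK (f`_m *: Q m)) hc; congr (_ + _).
by apply: eq_bigr => i _; rewrite (ltn_eqF (ltn_ord i)).
Qed.

Lemma veval_sumQ (c : nat -> rat) :
  veval r s (\sum_(i < n) c i *: Q i) (e 1) = \sum_(i < n) c i *: e i.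
Proof.
rewrite (eq_bigr (fun i : 'I_n => c i *: veval r s (Q i) (e 1))); last first.
  by move=> i _; rewrite veval_Q // ltnW.
by apply: (big_rec2 (fun f v => veval r s f (e 1) = v)) => [|i f v _ <-];
   rewrite ?veval0 ?vevalP.
Qed.

Lemma veval_modQ (f : {poly rat}) : veval r s f (e 1) = veval r s (f %% Q n) (e 1).
Proof.
rewrite {1}(divp_eq f (Q n)) -[_ * _]scale1r vevalP veval_mul veval_Q //.
by rewrite (ebasis_ge n) // vmulr0 scaler0 add0r.
Qed.

Lemma size_modQ (f : {poly rat}) : (size (f %% Q n)%R <= n)%N.
Proof. by rewrite -ltnS -(size_Q n) ltn_modp -size_poly_gt0 size_Q. Qed.

Lemma sum_ebasis_coord (c : nat -> rat) (k : 'I_n) : (\sum_(i < n) c i *: e i) 0 k = c k.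
Proof.
rewrite summxE (eq_bigr (fun i : 'I_n => c i * (i == k :> nat)%:R)).
  by rewrite (sum_delta n k c) ltn_ord.
by move=> i _; rewrite !mxE eq_sym.
Qed.

(** The remainder modulo [Q n] is a combination of the [Q i] with [i < n], and these go to the
    independent vectors [e i]. *)
Lemma veval_eq0 (f : {poly rat}) : veval r s f (e 1) = 0 <-> Q n %| f.
Proof.
rewrite veval_modQ /dvdp; have [c ->] := Q_span n _ (size_modQ f).
rewrite veval_sumQ; split=> [h|].
  rewrite big1 // => i _.
  by have := sum_ebasis_coord c i; rewrite h mxE => <-; rewrite scale0r.
by move=> /eqP h; rewrite -veval_sumQ h veval0.
Qed.

Lemma veval_onto (v : Vq r) : exists f : {poly rat}, veval r s f (e 1) = v.
Proof.
pose c i := if insub i is Some k then v 0 (k : 'I_n) else 0.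
exists (\sum_(i < n) c i *: Q i); rewrite veval_sumQ [RHS]ebasis_sum.
by apply: eq_bigr => i _; rewrite /c valK.
Qed.

(** * Continued fraction, Riley polynomial and counit *)

(** A Euclidean step: the recurrence coefficient is a sign, hence invertible. *)
Lemma coprimep_Q (k : nat) : (k.+1 <= n)%N -> coprimep (Q k) (Q k.+1).
Proof.
elim: k => [|k IH] hk; first by rewrite Ppoly0 toQ1 coprime1p.
rewrite (QSS k) coprimep_addl_mul coprimepZr; first by rewrite coprimep_sym IH // ltnW.
by apply: contra_eqN (sgpair_sq k hk) => /eqP ->; rewrite mul0r eq_sym oner_eq0.
Qed.

(** The fraction grows outwards with decreasing indices, the recurrence with increasing ones;
    [eps_n = eps_(r-n)] identifies the two. *)
Lemma cfrac_P (m : nat) : (m < n)%N ->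
  cfrac r s m (n - m) = tofrac (P m.+1) / tofrac (P m).
Proof.
elim: m => [|m IH] hm; first by rewrite Ppoly0 Ppoly1 rmorph1 divr1.
have jE : (n - m = (n - m.+1).+1)%N by lia.
rewrite /= -jE IH ?(ltnW hm) // PpolySS.
have -> : eps r s (n - m.+1) = eps r s m.+2.
  by rewrite -(eps_subr m.+2); [congr eps; lia | lia].
have -> : eps r s (n - m) = eps r s m.+1.
  by rewrite -(eps_subr m.+1); [congr eps; lia | lia].
have p0 : tofrac (P m.+1) != 0.
  by rewrite tofrac_eq0 monic_neq0 // (size_monic_Ppoly m.+1).2.
by rewrite invf_div rmorphD !rmorphM /= mulrDl mulfK // mulrA [tofrac _ * tofrac _]mulrC.
Qed.

(** For [r = 2h + 1] the signs at [h + i] and [h + 1 - i] agree, so the factors gained above [h]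
    equal those lost below it. *)
Lemma sgfact_sym (h m : nat) : r = h.*2.+1 -> (m <= h)%N -> sgfact (h + m) = sgfact (h - m).
Proof.
move=> rE; elim: m => [|m IH] hm; first by rewrite addn0 subn0.
rewrite addnS sgfactS IH ?(ltnW hm) //.
have hE : (h - m = (h - m.+1).+1)%N by lia.
have -> : eps r s (h + m).+1 = eps r s (h - m.+1).+1.
  by rewrite -(eps_subr (h + m).+1); [congr eps; lia | lia].
by rewrite hE sgfactS -mulrA eps_sq ?mulr1 //; lia.
Qed.

Lemma sgfact_n : sgfact n = 1.
Proof.
have rE : r = (r./2).*2.+1 by lia.
have := sgfact_sym _ _ rE (leqnn _); rewrite subnn sgfact0 => <-.
by congr sgfact; lia.
Qed.

(** [u] and [v] are the first row of the partial product at [t = X^2], the second entry scaled by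
    [X]. The sign in [S] turns the recurrence of [P] into [S_(k+2) = S_k + eps_(k+2) X S_(k+1)]. *)
Let M k : 'M[{poly int}]_2 := \prod_(1 <= i < k.+1) rileyA r s i.
Let u k := M k ord0 ord0 \Po 'X^2.
Let v k := 'X * (M k ord0 ord_max \Po 'X^2).
Let S k := (sgfact k)%:P * P k.

(** Right multiplication by a factor alters one column only, alternately the second and the first,
    and there performs one step of the recurrence for [S]. *)
Lemma riley_rec (k : nat) : (k.+1 < r)%N ->
  if odd k then u k.+1 = S k.+1 /\ v k.+1 = S k else u k.+1 = S k /\ v k.+1 = S k.+1.
Proof.
elim: k => [|k IH] hk.
  rewrite /u /v /M big_nat1 /rileyA /= !mxE /= /S Ppoly0 Ppoly1 sgfactS sgfact0 eps1.
  by rewrite !comp_polyC !mulr1 mul1r.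
have MS : M k.+2 = M k.+1 *m rileyA r s k.+2 by rewrite /M big_nat_recr.
have SS : S k.+2 = S k + (eps r s k.+2)%:P * 'X * S k.+1.
  rewrite /S PpolySS !sgfactS !rmorphM /=.
  have h1 : eps r s k.+1 * eps r s k.+1 = 1 by rewrite eps_sq //; lia.
  have h2 : eps r s k.+2 * eps r s k.+2 = 1 by rewrite eps_sq //; lia.
  by case_signs; ring.
have := IH (ltnW hk); rewrite SS /u /v MS !mxE !big_ord_recl !big_ord0 /rileyA /= negbK.
case: (odd k) => /=; rewrite !mxE /=.
all: have -> : lift ord0 ord0 = ord_max :> 'I_2 by apply/val_inj.
all: move=> [<- <-]; rewrite !(comp_polyD, comp_polyM, comp_polyC, comp_polyX).
all: by split; ring.
Qed.

Lemma Ppoly_riley : P n = riley r s \Po 'X^2.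
Proof.
have := riley_rec n.-1; rewrite (_ : n.-1.+1 = n); last by lia.
rewrite (_ : odd n.-1); last by lia.
move=> /(_ ltac:(lia)) [uE _].
have -> : riley r s \Po 'X^2 = u n by rewrite /u /M (_ : n.+1 = r) //; lia.
by rewrite uE /S sgfact_n mul1r.
Qed.

(** Among the [Q i] with [i < n] only the last reaches degree [n - 1], and it is monic. *)
Lemma veval_last (f : {poly rat}) (k : 'I_n) : k = n.-1 :> nat ->
  veval r s f (e 1) 0 k = (f %% Q n)`_k.
Proof.
move=> kE; rewrite veval_modQ; have [c ->] := Q_span n _ (size_modQ f).
rewrite veval_sumQ sum_ebasis_coord coef_sum (bigD1 k) //= coefZ.
have := Q_monic k; rewrite monicE /lead_coef size_Q => /eqP /= ->.
rewrite mulr1 big1 ?addr0 // => i ik; rewrite coefZ nth_default ?mulr0 // size_Q.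
by rewrite ltn_neqAle ik /= kE; have := ltn_ord i; lia.
Qed.

(** The triple [(j, r-2, r-2)] meets the bound [2r - 4] only for [j = 0], so the last coordinate of
    [x e_(r-2)] is the coordinate of [x] at [e_0]. *)
Lemma vmul_last (x : Vq r) (k : 'I_n) : k = n.-1 :> nat ->
  vmul r s x (e k) 0 k = counit r s x.
Proof.
move=> kE; rewrite {1}(ebasis_sum x) vmul_suml summxE /counit /Defs.eta.
apply: eq_bigr => j _; rewrite mxE vmul_ebasis ebasisE -mulrA; congr (_ * _).
have [->|j0] := posnP j.
  have := vmul_unit_ebasis k (ltn_ord k) => /(congr1 (fun y : Vq r => y 0 k)).
  rewrite vmul_ebasis ebasisE eqxx => ->.
  by rewrite /eta_diag eps1 mul1r.
by rewrite omega_coef_out ?mulr0 ?mul0r // /admissible; lia.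
Qed.

Lemma counit_veval (f : {poly rat}) :
  counit r s (veval r s f (e 1)) = ((f * Q n.-1) %% Q n)`_n.-1.
Proof.
have hk : (n.-1 < n)%N by lia.
rewrite -(veval_last _ (Ordinal hk)) // veval_mul veval_Q ?leq_pred //.
by rewrite (vmul_last _ (Ordinal hk)).
Qed.
End Roots.

Theorem theorem2 (r s : nat) :
  (3 <= r)%N -> odd r -> odd s -> coprime r s -> (0 < s < r)%N ->
  let P1 := Ppoly r s (r - 1) in        (* P_{r-1} *)
  let P2 := Ppoly r s (r - 2) in        (* P_{r-2} *)
  let e1 := ebasis r 1 in
  [/\ (* P_{r-2}, P_{r-1} are coprime monic of degrees r-2, r-1 *)
      [/\ P2 \is monic, P1 \is monic, size P2 = (r - 1)%N, size P1 = r
        & coprimep (toQ P2) (toQ P1)],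
      (* continued fraction expansion *)
      tofrac P1 / tofrac P2 = cfrac r s (r - 2) 1,
      (* (i) X |-> e_1 induces an algebra isomorphism Q[X]/(P_{r-1}) ~= V_q *)
      [/\ veval r s 1 e1 = ebasis r 0,
          forall (a : rat) (f g : {poly rat}),
            veval r s (a *: f + g) e1 = a *: veval r s f e1 + veval r s g e1,
          forall f g : {poly rat},
            veval r s (f * g) e1 = vmul r s (veval r s f e1) (veval r s g e1),
          forall f : {poly rat}, veval r s f e1 = 0 <-> toQ P1 %| f
        & forall v : Vq r, exists f : {poly rat}, veval r s f e1 = v],
      (* (ii) counit as a sum of residues over the complex roots of P_{r-1} *)
      (forall (f : {poly rat}) (zs : seq algC),
          uniq zs -> (forall z : algC, z \in zs <-> root (toC P1) z) ->
          ratr (counit r s (veval r s f e1))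
          = \sum_(z <- zs) residue (map_poly ratr f * toC P2) (toC P1) z)
    & (* (iii) P_{r-1}(X) = R(X^2) *)
      P1 = riley r s \Po 'X^2].
Proof.
move=> r3 r_odd s_odd co_rs s_bnd P1 P2 e1.
have nS : (r - 1 = (r - 2).+1)%N by lia.
split.
- have [s1 m1] := size_monic_Ppoly r s (r - 1); have [s2 m2] := size_monic_Ppoly r s (r - 2).
  split=> //; [by rewrite s2; lia | by rewrite s1; lia |].
  by rewrite /P1 /P2 [in X in coprimep _ X]nS; apply: coprimep_Q; rewrite // nS.
- have := cfrac_P r s s_odd co_rs s_bnd r3 r_odd (r - 2).
  have -> : (r - 1 - (r - 2) = 1)%N by lia.
  by move=> ->; rewrite /P1 nS.
- split.
  + exact: veval1.
  + by move=> a f g; apply: vevalP.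
  + by move=> f g; apply: veval_mul.
  + by move=> f; apply: veval_eq0.
  + exact: veval_onto.
- move=> f zs uzs zsP.
  have monC : toC P1 \is monic by rewrite toC_ratr monic_map // Q_monic.
  (* Remainders commute with the embedding of the rationals, so the coefficient given by
     [sum_residue] is the image of the one in [counit_veval]. *)
  rewrite counit_veval // sum_residue // !toC_ratr -rmorphM -map_modp coef_map.
  by rewrite size_map_poly size_Q /P1 /P2 nS.
exact: Ppoly_riley.
Qed.
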